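(* Let $n\ge 1$ and $w\in S_n$. Let $D(w)$ be the Rothe diagram of $w$ with columns $D_1,\ldots,D_n$, and set $d_j=\max(D_j)$ for each $j\in[n]$, with the convention $\max(\emptyset)=0$. Then \[\mathrm{Newton}(\mathfrak{G}_w)\subseteq \sum_{j=1}^n P_{\mathrm{sp}}(\mathrm{SM}_{d_j}(D_j)),\] where the sum is the Minkowski sum and each $P_{\mathrm{sp}}(\mathrm{SM}_{d_j}(D_j))\subseteq\mathbb{R}^{d_j}$ is regarded as a subset of $\mathbb{R}^n$ via the inclusion $\mathbb{R}^{d_j}\to\mathbb{R}^n$ appending zero coordinates.
   Context: Permutations act on the right; $s_j$ is the adjacent transposition swapping positions $j,j+1$, and $w(j)<w(j+1)$ is called an ascent. The divided difference operator on $\mathbb{Z}[x_1,\ldots,x_n]$ is $\partial_j f=\frac{f-s_j f}{x_j-x_{j+1}}$, where $s_jf$ swaps $x_j$ and $x_{j+1}$, and the isobaric divided difference is $\overline{\partial}_j f=\partial_j((1-x_{j+1})f)$. The Grothendieck polynomial $\mathfrak{G}_w$ is defined by $\mathfrak{G}_{w_0}=x_1^{n-1}x_2^{n-2}\cdots x_{n-1}$ for $w_0=n\,(n-1)\cdots 1$, and $\mathfrak{G}_w=\overline{\partial}_j\mathfrak{G}_{ws_j}$ whenever $w(j)<w(j+1)$. The support of a polynomial is the set of exponent vectors of its monomials with nonzero coefficient; $\mathrm{Newton}(f)$ is the convex hull of its support. The Rothe diagram is $D(w)=\{(i,j)\in[n]^2: i<w^{-1}(j),\ j<w(i)\}$,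 with column $D_j=\{i:(i,j)\in D(w)\}$. For $1\le s_1<\cdots<s_r\le m$, the Schubert matroid $\mathrm{SM}_m(\{s_1,\ldots,s_r\})$ is the matroid on ground set $[m]$ whose bases are the sets $\{a_1<\cdots<a_r\}\subseteq[m]$ with $a_k\le s_k$ for all $k$ (for $r=0$ the only basis is $\emptyset$). A spanning set of a matroid is a set containing some basis, and the spanning set polytope $P_{\mathrm{sp}}(M)$ is the convex hull of the indicator vectors of the spanning sets of $M$. *)

(* Defs.v *)
From HB Require Import structures.
From mathcomp Require Import all_boot all_order all_algebra all_fingroup.
From mathcomp Require Import mpoly.
From Stdlib Require Import ClassicalEpsilon.
Set Implicit Arguments. Unset Strict Implicit. Unset Printing Implicit Defensive.
Import Order.TTheory GRing.Theory Num.Theory.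
Local Open Scope ring_scope.

(* Conventions: [n] = {1,...,n} is encoded by 'I_n, the ordinal i standing
   for the integer i+1.  Permutations w of S_n are elements of 'S_n, and
   w(i) for i in [n] is w applied to the ordinal. *)

Section Defs.
Variable n : nat.

(* the "next" index j+1 (only used when j.+1 < n) *)
Definition nextord (j : 'I_n) : 'I_n := insubd j j.+1.

(* adjacent transposition s_j, j in [n-1] (encoded j : 'I_n with j.+1 < n) *)
Definition sadj (j : 'I_n) : 'S_n := tperm j (nextord j).

(* right action: (w s_j)(i) = w(s_j(i)), i.e. swap positions j, j+1.
   In mathcomp (s * t) x = t (s x). *)
Definition rmul_s (w : 'S_n) (j : 'I_n) : 'S_n := (sadj j * w)%g.

Definition ascent (w : 'S_n) (j : 'I_n) : bool :=
  (j.+1 < n)%N && (w j < w (nextord j))%N.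

Definition poly := {mpoly int[n]}.

Definition swapvar (j : 'I_n) (f : poly) : poly := msym (sadj j) f.

Definition divdiff (j : 'I_n) (f : poly) : poly :=
  epsilon (inhabits 0)
    (fun q : poly => ('X_j - 'X_(nextord j)) * q = f - swapvar j f).

Definition idivdiff (j : 'I_n) (f : poly) : poly :=
  divdiff j ((1 - 'X_(nextord j)) * f).

Definition staircase : poly := 'X_[ [multinom (n - 1 - i)%N | i < n] ].

(* G_w = isobaric_dd_j G_{w s_j} for the first ascent j of w; G_{w0} is the
   staircase monomial (w0 is the only permutation without ascents).  The
   fuel argument bounds the recursion; n*n exceeds the number of
   non-inversions of any w, and extra fuel is harmless since at w0 the
   staircase is returned. *)
Fixpoint groth_aux (k : nat) (w : 'S_n) : poly :=
  match k with
  | 0 => staircase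
  | k'.+1 =>
      match [pick j | ascent w j] with
      | Some j => idivdiff j (groth_aux k' (rmul_s w j))
      | None => staircase
      end
  end.

Definition grothendieck (w : 'S_n) : poly := groth_aux (n * n) w.

Variable R : realFieldType.
Definition vec := 'rV[R]_n.

Definition conv (P : vec -> Prop) (x : vec) : Prop :=
  exists (k : nat) (p : 'I_k -> vec) (l : 'I_k -> R),
    (forall i, P (p i)) /\ (forall i, 0 <= l i) /\
    \sum_(i < k) l i = 1 /\ x = \sum_(i < k) l i *: p i.

Definition minkowski_sum (A : 'I_n -> vec -> Prop) (x : vec) : Prop :=
  exists y : 'I_n -> vec, (forall j, A j (y j)) /\ x = \sum_(j < n) y j.

Definition expvec (m : 'X_{1..n}) : vec := \row_i ((m i)%:R).

Definition newton (f : poly) : vec -> Prop :=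
  conv (fun x => exists2 m, m \in msupp f & x = expvec m).

Definition indic (S : {set 'I_n}) : vec := \row_i ((i \in S)%:R).

Definition rothe (w : 'S_n) : {set 'I_n * 'I_n} :=
  [set ij : 'I_n * 'I_n | ((ij.1 < (w^-1)%g ij.2) && (ij.2 < w ij.1))%N].

Definition rothe_col (w : 'S_n) (j : 'I_n) : {set 'I_n} :=
  [set i | (i, j) \in rothe w].

(* max of a subset of [n] (as an integer in {1..n}), with max(empty) = 0 *)
Definition colmax (A : {set 'I_n}) : nat := \max_(i in A) (val i).+1.

Definition sorted_elts (A : {set 'I_n}) : seq nat :=
  sort leq [seq (val i).+1 | i in A].

(* Schubert matroid SM_m(S) on ground set [m] (m <= n, [m] viewed inside [n]):
   bases are {a_1<...<a_r} subset of [m] with a_k <= s_k, r = |S|. *)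
Definition sm_basis (m : nat) (S B : {set 'I_n}) : Prop :=
  (forall i, i \in B -> (val i < m)%N) /\ #|B| = #|S| /\
  (forall k, (k < #|B|)%N -> (nth 0 (sorted_elts B) k <= nth 0 (sorted_elts S) k)%N).

Definition sm_spanning (m : nat) (S A : {set 'I_n}) : Prop :=
  (forall i, i \in A -> (val i < m)%N) /\ exists2 B, sm_basis m S B & B \subset A.

(* spanning set polytope of SM_m(S), embedded in R^n by zero padding *)
Definition spanning_polytope (m : nat) (S : {set 'I_n}) : vec -> Prop :=
  conv (fun x => exists2 A, sm_spanning m S A & x = indic A).

End Defs.

(* Main.v *)
(* Let T(w) be the set of exponents [sum_c 1_(A_c)] with [A_c] a spanning set
   of the Schubert matroid of the column [D_c(w)], that is, [A_c] has no element
   beyond [max D_c(w)] and meets every initial interval in at least as many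
   elements as [D_c(w)]. It suffices to show that the support of the
   Grothendieck polynomial lies in T(w), by induction along the recursion.

   Let [v = w s_j] with [j] the FIRST ascent of [w]. Then w(1) > ... > w(j), so
   the column [c0 = w(j)] is [1..j-1] in D(w) and [1..j] in D(v); the other
   columns of D(w) are those of D(v) with rows [j] and [j+1] swapped. An element
   of T(v) with exponents (p+1, q) in positions [j], [j+1], one unit of p+1 being
   due to [c0], is sent by the isobaric divided difference to monomials with
   exponents (a, b), where a and b lie between p and q and a + b is p + q or
   p + q + 1. To realise these in T(w), replace, in the columns other than [c0]
   with exactly one of [j], [j+1] in [A_c], this element by a nonempty subset
   of {j, j+1}: the result still dominates [D_c(w)].

   For an arbitrary ascent the support alone does not suffice: for [w = id] in
   S_3 and [j = 2], the monomial [x_1] in the image of [x_1] cancels against the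
   one from [x_1 x_2], and it does not lie in T(id). *)
Require Import Defs.
From HB Require Import structures.
From mathcomp Require Import all_boot all_order all_algebra all_fingroup.
From mathcomp Require Import mpoly.
From mathcomp Require Import zify ring.
From Stdlib Require Import ClassicalEpsilon.
Import GRing.Theory.
Local Open Scope ring_scope.

Set Implicit Arguments.
Unset Strict Implicit.
Unset Printing Implicit Defensive.

(** [pick] takes the head of the enumeration, which lists ordinals increasingly; hence the recursion
    always uses the first ascent. *)
Lemma ord_pick_first (n : nat) (P : pred 'I_n) (j : 'I_n) :
  [pick i | P i] = Some j -> P j /\ forall i : 'I_n, (i < j)%N -> ~~ P i.
Proof.
rewrite /pick.
have : sorted (fun a b : 'I_n => a < b)%N (enum P).
  rewrite /(enum P) /enum_mem -enumT.
  apply: sorted_filter; first by move=> a b c; apply: ltn_trans.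
  by rewrite -(@sorted_map _ _ val ltn) val_enum_ord iota_ltn_sorted.
have memP i : (i \in enum P) = P i by rewrite mem_enum.
change (enum [pred x | P x]) with (enum P).
case: (enum P) memP => [|a e] //= memP pth [<-{j}].
split=> [|i lt_ia]; first by rewrite -memP mem_head.
rewrite -memP inE negb_or; apply/andP; split.
  by apply: contraTneq lt_ia => ->; rewrite ltnn.
have tr : transitive (fun a b : 'I_n => (a < b)%N) by move=> x y z; apply: ltn_trans.
apply: contraL lt_ia => ie; rewrite -leqNgt ltnW //.
by move/allP: (order_path_min tr pth) => /(_ i ie).
Qed.

Lemma subset_of_card (T : finType) (A : {set T}) (k : nat) :
  (k <= #|A|)%N -> exists2 B : {set T}, B \subset A & #|B| = k.
Proof.
move=> le_kA; exists [set x in take k (enum A)].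
  by apply/subsetP => x; rewrite inE => /mem_take; rewrite mem_enum.
rewrite cardsE; have /card_uniqP -> : uniq (take k (enum A)).
  by apply: take_uniq; apply: enum_uniq.
by rewrite size_takel // -cardE.
Qed.

(** * Spanning sets of Schubert matroids through prefix counts *)

Section SpanningSets.
Variable n : nat.
Implicit Types S A B : {set 'I_n}.

Definition prefix_card (k : nat) A : nat :=
  (\sum_(i < n) ((i \in A) && (i < k)))%N.

(* Spanning sets of the Schubert matroid of [S] on [max S], described by
   prefix counts instead of bases. *)
Definition dominates S A : Prop :=
  (forall i, i \in A -> (i < colmax S)%N) /\
  (forall k, (prefix_card k S <= prefix_card k A)%N).

Lemma prefix_card_full A k : (n <= k)%N -> prefix_card k A = #|A|.
Proof.
move=> le_nk; rewrite -sum1_card big_mkcond /=; apply: eq_bigr => i _.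
by rewrite (leq_trans (ltn_ord i) le_nk) andbT; case: (i \in A).
Qed.

Lemma prefix_card_le A k : (prefix_card k A <= #|A|)%N.
Proof.
rewrite -(prefix_card_full A (leqnn n)); apply: leq_sum => i _.
by rewrite (ltn_ord i) andbT; case: (i \in A) => //; case: (_ < k)%N.
Qed.

Lemma lt_colmax S i : i \in S -> (i < colmax S)%N.
Proof. by move=> iS; exact: (@leq_bigmax_cond _ (mem S) (fun i : 'I_n => i.+1)). Qed.

Lemma colmax_leP S m :
  reflect (forall i, i \in S -> (i < m)%N) (colmax S <= m)%N.
Proof. exact: (@bigmax_leqP _ (mem S) m (fun i : 'I_n => i.+1)). Qed.

Lemma dominates_refl S : dominates S S.
Proof. by split=> [i /lt_colmax|]. Qed.

(** In a sorted list the entries at most [x] form an initial segment. This turns the entrywise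
    comparison of bases into prefix counts. *)
Lemma sorted_elts_leP S k x :
  (k < #|S|)%N -> (nth 0 (sorted_elts S) k <= x)%N = (k < prefix_card x S)%N.
Proof.
move=> lt_kS.
have -> : prefix_card x S = count (fun y => y <= x)%N (sorted_elts S).
  rewrite /sorted_elts (seq.permP (permEl (perm_sort _ _))) count_map /prefix_card.
  rewrite -sum1_count big_enum_cond /= [RHS]big_mkcond.
  by apply: eq_bigr => i _ /=; case: (_ && _).
have sz : size (sorted_elts S) = #|S| by rewrite size_sort size_map -cardE.
have : sorted leq (sorted_elts S) by apply: sort_sorted; apply: leq_total.
move: lt_kS; rewrite -{}sz; elim: (sorted_elts S) k => [//|a s IHs] [|k] /=.
  move=> _ /(order_path_min leq_trans) /allP pth.
  case: (leqP a x) => //= lt_xa; symmetry; apply/negbTE; rewrite add0n -leqNgt leqn0.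
  rewrite -[_ == 0%N]negbK -lt0n -has_count; apply/hasPn => y /pth.
  by rewrite -ltnNge; apply: leq_trans.
rewrite ltnS => lt_ks pth; rewrite IHs // ?(path_sorted pth) //.
move/(order_path_min leq_trans)/allP: pth => pth.
case: (leqP a x) => //= lt_xa; rewrite add0n.
have -> : count (fun y => y <= x)%N s = 0%N.
  apply/eqP; rewrite -[_ == 0%N]negbK -lt0n -has_count; apply/hasPn => y /pth.
  by rewrite -ltnNge; apply: leq_trans.
by [].
Qed.

(* Discarding maximal elements of [A] keeps the prefix inequalities until the
   cardinality drops to that of [S]. *)
Lemma dominates_basis S A :
  (forall k, (prefix_card k S <= prefix_card k A)%N) ->
  exists B : {set 'I_n}, [/\ B \subset A, #|B| = #|S| &
    forall k, (prefix_card k S <= prefix_card k B)%N].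
Proof.
move: {-1}(#|A|) (erefl #|A|) => a; elim: a A => [|a IHa] A cA domA.
  exists A; split=> //; apply/eqP; rewrite cA eq_sym -leqn0 -cA.
  by rewrite -!(prefix_card_full _ (leqnn n)).
have : (#|S| <= #|A|)%N by rewrite -!(prefix_card_full _ (leqnn n)).
rewrite leq_eqVlt => /orP[/eqP eqSA|ltSA]; first by exists A; split.
have /set0Pn [x0 x0A] : A != set0 by rewrite -cards_eq0 cA.
pose x := [arg max_(i > x0 in A) (i : nat)].
have [xA maxx] : x \in A /\ forall i, i \in A -> (i <= x)%N.
  by rewrite /x; case: arg_maxnP => // y yA my; split.
have cAx : #|A :\ x| = a by move: (cardsD1 x A); rewrite xA cA => -[].
have [k|B [sBA cB domB]] := IHa _ cAx; last first.
  by exists B; split=> //; apply: subset_trans sBA (subsetDl _ _).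
(* If [x < k], all of [A :\ x] lies below [k], and its size [a] is at least [#|S|]; otherwise the
   prefix does not contain [x]. *)
have [lt_xk|le_kx] := ltnP x k.
  have -> : prefix_card k (A :\ x) = #|A :\ x|.
    rewrite -(prefix_card_full (A :\ x) (leqnn n)); apply: eq_bigr => i _.
    rewrite (ltn_ord i) andbT !inE.
    case iA: (i \in A); rewrite ?andbF //.
    by rewrite (leq_ltn_trans (maxx _ iA) lt_xk) andbT.
  apply: leq_trans (prefix_card_le S k) _.
  by rewrite cAx -ltnS -cA.
apply: leq_trans (domA k) _; apply: leq_sum => i _; rewrite !inE.
case: eqP => [->|_] //=.
by rewrite ltnNge le_kx andbF.
Qed.

Lemma dominates_spanning S A : dominates S A -> sm_spanning (colmax S) S A.
Proof.
case=> ltA /dominates_basis [B [sBA cB domB]]; split=> //; exists B => //.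
split=> [i iB|]; first by apply: ltA; apply: (subsetP sBA).
split=> // k lt_kB; rewrite sorted_elts_leP //.
by apply: leq_trans (domB _); rewrite -sorted_elts_leP // -cB.
Qed.

End SpanningSets.

(** The coefficients of a convex combination of exponents serve again in every column. *)
Lemma newton_subset_minkowski (n : nat) (R : realFieldType) (f : Defs.poly n)
    (D : 'I_n -> {set 'I_n}) :
  (forall m, m \in msupp f -> exists2 A : 'I_n -> {set 'I_n},
     forall c, dominates (D c) (A c) & forall i, m i = (\sum_c (i \in A c))%N) ->
  forall x, newton (R:=R) f x ->
  minkowski_sum (fun c => spanning_polytope (R:=R) (colmax (D c)) (D c)) x.
Proof.
move=> suppD x [k [p [l [suppp [l_ge0 [suml ->]]]]]].
have /fin_all_exists2 [A domA pA] (i : 'I_k) :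
    exists2 A : 'I_n -> {set 'I_n}, forall c, dominates (D c) (A c) &
      p i = \sum_c indic R (A c).
  have [m /suppD [A domA mA] ->] := suppp i; exists A => //.
  by apply/rowP => t; rewrite !mxE summxE mA natr_sum; apply: eq_bigr => c _; rewrite mxE.
exists (fun c => \sum_i l i *: indic R (A i c)); split.
  move=> c; exists k, (fun i => indic R (A i c)), l; split=> // i.
  by exists (A i c) => //; apply: dominates_spanning.
by rewrite exchange_big; apply: eq_bigr => i _; rewrite pA scaler_sumr.
Qed.

(** * Columns and spanning sets under a swap of adjacent rows *)

Section AdjacentRows.
Variables (n : nat) (j j1 : 'I_n).
Hypothesis j1E : j1 = j.+1 :> nat.

(** Meant for a column [S] of D(w s_j) and the same column [S'] of D(w); the last clause reflects
    w(j) < w(j+1). *)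
Definition row_swapped (S S' : {set 'I_n}) : Prop :=
  [/\ forall i, i != j -> i != j1 -> (i \in S') = (i \in S),
      (j \in S') = (j1 \in S), (j1 \in S') = (j \in S) & j \in S' -> j1 \in S'].

Let off_prefix (k : nat) (A : {set 'I_n}) : nat :=
  (\sum_(i < n | (i != j) && (i != j1)) ((i \in A) && (i < k)))%N.

Lemma prefix_card_split k A :
  prefix_card k A =
  (((j \in A) && (j < k)%N) + (((j1 \in A) && (j1 < k)%N) + off_prefix k A))%N.
Proof.
rewrite /prefix_card (bigD1 j) //= (bigD1 j1) //=.
by apply/eqP => /(congr1 val) /=; lia.
Qed.

Let off_prefix_eq k (A B : {set 'I_n}) :
  (forall i, i != j -> i != j1 -> (i \in A) = (i \in B)) ->
  off_prefix k A = off_prefix k B.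
Proof. by move=> eqAB; apply: eq_bigr => i /andP[ij ij1]; rewrite eqAB. Qed.

Let off_prefix_const k A : (j <= k)%N -> (k <= j.+2)%N -> off_prefix k A = off_prefix j A.
Proof.
move=> le_jk le_kj; apply: eq_bigr => i /andP[]; rewrite -!val_eqE /= j1E => ij ij1.
by congr (_ && _); apply/idP/idP; lia.
Qed.

Lemma colmax_row_swapped S S' : row_swapped S S' -> (colmax S <= colmax S')%N.
Proof.
case=> eqS jS' j1S' jj1; apply/colmax_leP => i iS.
have [eij|neij] := eqVneq i j.
  have := @lt_colmax _ S' j1; rewrite j1S' -eij => /(_ iS); rewrite j1E eij; lia.
have [eij1|neij1] := eqVneq i j1.
  by apply: lt_colmax; rewrite eij1; apply: jj1; rewrite jS' -eij1.
by apply: lt_colmax; rewrite eqS.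
Qed.

(** Only the prefix ending at [j] changes, and its count cannot grow, since [j1 \in S] implies
    [j \in S]. *)
Lemma dominates_row_swapped S S' A :
  row_swapped S S' -> dominates S A -> dominates S' A.
Proof.
move=> sw [ltA domA]; have le_max := colmax_row_swapped sw.
split=> [i /ltA lt_i|k]; first exact: leq_trans lt_i le_max.
apply: leq_trans (domA k); case: sw => eqS jS' j1S' jj1.
rewrite !prefix_card_split (off_prefix_eq k eqS) jS' j1S'.
move: jj1; rewrite jS' j1S'.
by case: (j \in S); case: (j1 \in S) => //=; lia.
Qed.

(** The critical prefix ends at [j]. If [j \in S'], then [S] contains both rows and [A] only one, so
    [A] already has a surplus below [j]. *)
Lemma dominates_replace S S' A (A' : {set 'I_n}) :
  row_swapped S S' -> dominates S A -> (j \in A) (+) (j1 \in A) ->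
  (forall i, i != j -> i != j1 -> (i \in A') = (i \in A)) ->
  (j \in A') || (j1 \in A') -> dominates S' A'.
Proof.
move=> sw [ltA domA] xorA eqA orA'; have le_max := colmax_row_swapped sw.
case: (sw) => eqS jS' j1S' jj1.
(* [A'] may reach [j1]. Since [A] meets the two rows, [S] has an element in row [j] or beyond, hence
   [S'] has one in row [j1] or beyond. *)
have lt_j1 : (j1 < colmax S')%N.
  have lt_jS : (j < colmax S)%N.
    by case: (boolP (j \in A)) xorA => [/ltA //|_ /= /ltA]; lia.
  rewrite ltnNge; apply/negP => le_max1.
  have j1nS' : j1 \notin S' by apply/negP => /lt_colmax; lia.
  have : (colmax S <= j)%N; last by lia.
  apply/colmax_leP => i iS; rewrite ltnNge; apply/negP => le_ji.
  have [eij|neij] := eqVneq i j; first by rewrite j1S' -eij iS in j1nS'.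
  have [eij1|neij1] := eqVneq i j1.
    by rewrite jj1 // jS' -eij1 in j1nS'.
  have : i \in S' by rewrite eqS.
  by move=> /lt_colmax; move: neij neij1; rewrite -!val_eqE /= j1E; lia.
split=> [i iA'|k].
  have [->|neij] := eqVneq i j; first by lia.
  have [->|neij1] := eqVneq i j1; first by lia.
  by apply: leq_trans le_max; apply: ltA; rewrite -eqA.
have := domA k; have := domA j; have := domA j.+2.
rewrite !prefix_card_split !(off_prefix_eq _ eqA) !(off_prefix_eq _ eqS) jS' j1S' j1E.
rewrite (@off_prefix_const j.+2 A) ?(@off_prefix_const j.+2 S) //; try lia.
have [ek|nek] := eqVneq k j.+1.
  rewrite ek !(@off_prefix_const j.+1) //.
  move: xorA orA' jj1; rewrite jS' j1S'.
  have -> : (j < j.+2)%N = true by lia.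
  have -> : (j.+1 < j.+2)%N = true by lia.
  have -> : (j < j.+1)%N = true by lia.
  rewrite !ltnn (_ : (j.+1 < j)%N = false); last by lia.
  by case: (j \in A); case: (j1 \in A); case: (j \in A'); case: (j1 \in A');
    case: (j \in S); case: (j1 \in S) => //=; lia.
(* Any other prefix contains both rows or neither. *)
have -> : (j.+1 < k)%N = (j < k)%N by apply/idP/idP; lia.
move: xorA orA'.
by case: (j \in A); case: (j1 \in A); case: (j \in A'); case: (j1 \in A');
    case: (j \in S); case: (j1 \in S); case: (j < k)%N => //=; lia.
Qed.

(* Among the columns other than [c0], let [G] be those whose set contains both
   [j] and [j1] and [C] those whose set contains exactly one of them. Each
   column of [C] may be given any nonempty subset of [{j, j1}]. *)
Lemma dominates_redistribute (D D' A : 'I_n -> {set 'I_n}) (c0 : 'I_n) (p q r s : nat) :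
  (forall c, dominates (D c) (A c)) ->
  (forall c, c != c0 -> row_swapped (D c) (D' c)) ->
  A c0 = D c0 -> D' c0 = D c0 :\ j -> j \in D c0 -> j1 \notin D c0 ->
  (\sum_c (j \in A c) = p.+1)%N -> (\sum_c (j1 \in A c) = q)%N ->
  (minn p q <= r <= maxn p q)%N -> (minn p q <= s <= maxn p q)%N ->
  (p + q <= r + s)%N ->
  exists A' : 'I_n -> {set 'I_n}, [/\ forall c, dominates (D' c) (A' c),
    (\sum_c (j \in A' c) = r)%N, (\sum_c (j1 \in A' c) = s)%N &
    forall i, i != j -> i != j1 -> (\sum_c (i \in A' c) = \sum_c (i \in A c))%N].
Proof.
move=> domA sw Ac0 D'c0 jD j1D sumj sumj1 rP sP rsP.
have nej : (j1 == j) = false by apply/negbTE; rewrite -val_eqE /= j1E; lia.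
pose C := [set c | (c != c0) && ((j \in A c) (+) (j1 \in A c))].
pose G := [set c | (c != c0) && ((j \in A c) && (j1 \in A c))].
have sum_card (P : pred 'I_n) : (\sum_c P c = #|[set c | P c]|)%N.
  by rewrite -sum1dep_card [RHS]big_mkcond; apply: eq_bigr => c _; case: (P c).
have c0C : c0 \in C = false by rewrite inE eqxx.
have [g gE] : exists g, #|G| = g by exists #|G|.
(* [a] and [b] count the columns of [C] containing only [j] and only [j1]; the column [c0] gives the
   extra unit in [p.+1]. *)
have [a [b [pE qE CE]]] :
    exists a b, [/\ p = (a + g)%N, q = (b + g)%N & #|C| = (a + b)%N].
  exists (\sum_c ((c != c0) && ((j \in A c) && (j1 \notin A c))))%N.
  exists (\sum_c ((c != c0) && ((j \notin A c) && (j1 \in A c))))%N.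
  rewrite -gE -!sum_card -!big_split /=; split.
  - apply/eqP; rewrite -eqSS -sumj (bigD1 c0) //= Ac0 jD add1n eqSS.
    rewrite [X in _ == X](bigD1 c0) //= eqxx /= add0n; apply/eqP/eq_bigr => c ->.
    by case: (j \in _); case: (j1 \in _).
  - rewrite -sumj1 (bigD1 c0) //= Ac0 (negbTE j1D) add0n.
    rewrite [RHS](bigD1 c0) //= eqxx /= add0n; apply: eq_bigr => c ->.
    by case: (j \in _); case: (j1 \in _).
  - apply: eq_bigr => c _.
    by case: (c != c0); case: (j \in _); case: (j1 \in _).
(* The columns in [X] will receive [j], those in [Y] will receive [j1]. Taking the complement [Z] of
   [Y] inside [X] makes them cover [C]; there is room because [p + q <= r + s]. *)
have [X sXC cX] : exists2 X : {set 'I_n}, X \subset C & #|X| = (r - g)%N.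
  by apply: subset_of_card; rewrite CE; lia.
have [Z sZX cZ] : exists2 Z : {set 'I_n}, Z \subset X & #|Z| = (a + b - (s - g))%N.
  by apply: subset_of_card; rewrite cX; lia.
pose Y := C :\: Z.
have cY : #|Y| = (s - g)%N.
  rewrite cardsD (setIidPr _) ?cZ ?CE; last exact: subset_trans sXC.
  by lia.
(* Outside [C] only the column [c0] changes: it loses [j], as [D' c0] does. *)
pose A' c := [set i | if c \in C then
    (if i == j then c \in X else if i == j1 then c \in Y else i \in A c)
  else (i \in A c) && ~~ ((c == c0) && (i == j))].
have sumA' (i : 'I_n) (W : {set 'I_n}) : W \subset C ->
    (forall c, c \in C -> (i \in A' c) = (c \in W)) ->
    (forall c, c \notin C -> (i \in A' c) = (c \in G)) ->
    (\sum_c (i \in A' c) = #|W| + g)%N.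
  move=> sWC inC outC; rewrite -gE sum_card -cardsUI [X in (_ = _ + X)%N]eq_card0.
    rewrite addn0; apply: eq_card => c; rewrite in_set in_setU.
    case: (boolP (c \in C)) => cC; last first.
      by rewrite outC // (contraNF (subsetP sWC c) cC).
    rewrite inC //; case: (c \in W) => //=; symmetry.
    by move: cC; rewrite !in_set; case: (c != c0); case: (j \in _); case: (j1 \in _).
  move=> c; rewrite in_setI; apply/negbTE/negP => /andP[/(subsetP sWC)].
  by rewrite !in_set; case: (c != c0); case: (j \in _); case: (j1 \in _).
exists A'; split.
- move=> c; case: (boolP (c \in C)) => cC.
    have /andP [ncc0 xorc] : (c != c0) && ((j \in A c) (+) (j1 \in A c)) by rewrite inE in cC.
    apply: (dominates_replace (sw c ncc0) (domA c)) => //.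
      by move=> i ij ij1; rewrite in_set cC (negbTE ij) (negbTE ij1).
    rewrite [j \in A' c]in_set [j1 \in A' c]in_set cC eqxx nej eqxx in_setD cC andbT.
    by case: (boolP (c \in Z)) => [/(subsetP sZX) ->|]; rewrite ?orbT.
  have [ecc0|ncc0] := eqVneq c c0.
    suff -> : A' c = D' c by apply: dominates_refl.
    by apply/setP => i; rewrite in_set (negbTE cC) ecc0 eqxx D'c0 Ac0 !inE andbC.
  suff -> : A' c = A c by apply: dominates_row_swapped (sw c ncc0) (domA c).
  by apply/setP => i; rewrite in_set (negbTE cC) (negbTE ncc0) andbT.
- rewrite (sumA' j X) //; first by lia.
    by move=> c cC; rewrite in_set cC eqxx.
  move=> c cC; rewrite in_set (negbTE cC) eqxx andbT in_set.
  by move: cC; rewrite in_set; case: (c =P c0) => //=; rewrite ?andbF //=;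
    case: (j \in _); case: (j1 \in _).
- rewrite (sumA' j1 Y); first by rewrite cY; lia.
  + by apply: subsetDl.
  + by move=> c cC; rewrite in_set cC eqxx nej.
  move=> c cC; rewrite in_set (negbTE cC) nej andbF andbT in_set.
  move: cC; rewrite in_set; case: (c =P c0) => [->|] //=; first by rewrite Ac0 (negbTE j1D).
  by case: (j \in _); case: (j1 \in _).
- move=> i ij ij1; apply: eq_bigr => c _.
  by rewrite in_set (negbTE ij) (negbTE ij1) andbF andbT; case: ifP.
Qed.

End AdjacentRows.

(** * Support of isobaric divided differences *)

Lemma subr_mul_geometric (R : comNzRingType) (y z : R) (a d : nat) :
  (y - z) * (\sum_(i < d) y ^+ (a + (d.-1 - i)) * z ^+ (a + i)) =
  y ^+ a * z ^+ a * (y ^+ d - z ^+ d).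
Proof.
rewrite subrXX mulrCA; congr (_ * _); rewrite big_distrr; apply: eq_bigr => i _ /=.
by rewrite !exprD; ring.
Qed.

Section IsobaricSupport.
Variables (n : nat) (j : 'I_n).
Hypothesis lt_jn : (j.+1 < n)%N.
Let j1 := nextord j.

Lemma val_nextord : j1 = j.+1 :> nat.
Proof. by rewrite /j1 /nextord val_insubd lt_jn. Qed.

Let neq_j1j : (j1 == j) = false.
Proof. by apply/negbTE; rewrite -val_eqE /= val_nextord; lia. Qed.

Let neq_jj1 : (j == j1) = false.
Proof. by rewrite eq_sym neq_j1j. Qed.

(** Polynomials over the integers form a domain, so the quotient selected by [epsilon] is the only
    one. *)
Lemma divdiff_unique (f q : Defs.poly n) :
  ('X_j - 'X_j1) * q = f - swapvar j f -> divdiff j f = q.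
Proof.
move=> qE; apply: (@mulfI _ ('X_j - 'X_j1)).
  apply/eqP => /(congr1 (fun p => p@_U_(j))) /eqP.
  by rewrite mcoeffB !mcoeffXU eqxx neq_j1j mcoeff0 subr0 oner_eq0.
rewrite qE /divdiff; apply: (epsilon_spec (inhabits 0)
  (fun q : Defs.poly n => ('X_j - 'X_j1) * q = f - swapvar j f)).
by exists q.
Qed.

Definition with_exponents (m : 'X_{1..n}) (a b : nat) : 'X_{1..n} :=
  [multinom if i == j then a else if i == j1 then b else m i | i < n].

Let rest m : Defs.poly n := 'X_[with_exponents m 0 0].

Let mpolyX_with_exponents m a b :
  'X_[with_exponents m a b] = 'X_j ^+ a * 'X_j1 ^+ b * rest m :> Defs.poly n.
Proof.
rewrite !mpolyXn -!mpolyXD; congr 'X_[_]; apply/mnmP => i.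
rewrite !mnmDE !mulmnE !mnmE (eq_sym j) (eq_sym j1).
have [->|_] := eqVneq i j; first by rewrite neq_jj1; lia.
by case: (i == j1); lia.
Qed.

Lemma with_exponents_id m : with_exponents m (m j) (m j1) = m.
Proof.
apply/mnmP => i; rewrite mnmE.
by have [->|_] := eqVneq i j => //; have [->|_] := eqVneq i j1.
Qed.

Let swap_with_exponents m a b :
  swapvar j 'X_[with_exponents m a b] = 'X_[with_exponents m b a] :> Defs.poly n.
Proof.
rewrite /swapvar msymX; congr 'X_[_]; apply/mnmP => i.
rewrite !mnmE /sadj tpermV -/j1; case: tpermP => [->|->|/eqP/negbTE nij /eqP/negbTE nij1].
- by rewrite neq_j1j !eqxx.
- by rewrite neq_j1j !eqxx.
- by rewrite nij nij1.
Qed.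

(** The terms of the factor [1 - 'X_j1] give two geometric sums of opposite signs, of degrees
    [p + q] and [p + q + 1] in the two variables. *)
Lemma idivdiff_monomial (m : 'X_{1..n}) (p q : nat) : m j = p.+1 -> m j1 = q ->
  exists2 g : Defs.poly n,
    ('X_j - 'X_j1) * g =
      (1 - 'X_j1) * 'X_[m] - swapvar j ((1 - 'X_j1) * 'X_[m]) &
    forall m', m' \in msupp g -> exists a b,
      [/\ m' = with_exponents m a b, (minn p q <= a <= maxn p q)%N,
          (minn p q <= b <= maxn p q)%N & (p + q <= a + b)%N].
Proof.
move=> pE qE.
(* [geo a d] is the divided difference of the monomial with exponents [a + d] and [a] at [j] and
   [j1]. *)
pose geo a d : Defs.poly n :=
  \sum_(i < d) 'X_[with_exponents m (a + (d.-1 - i)) (a + i)].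
have geoE a d : ('X_j - 'X_j1) * geo a d =
    'X_j ^+ a * 'X_j1 ^+ a * ('X_j ^+ d - 'X_j1 ^+ d) * rest m.
  rewrite -subr_mul_geometric -mulrA; congr (_ * _); rewrite big_distrl.
  by apply: eq_bigr => i _; rewrite mpolyX_with_exponents.
have geo_supp a d m' : m' \in msupp (geo a d) -> exists2 i, (i < d)%N &
    m' = with_exponents m (a + (d.-1 - i)) (a + i).
  move=> /msupp_sum_le /flattenP [s /mapP [i _ ->]] /mem_msuppXP <-.
  by exists i.
have -> : (1 - 'X_j1) * 'X_[m] - swapvar j ((1 - 'X_j1) * 'X_[m]) =
    ((1 - 'X_j1) * ('X_j ^+ p.+1 * 'X_j1 ^+ q) -
     (1 - 'X_j) * ('X_j1 ^+ p.+1 * 'X_j ^+ q)) * rest m.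
  have -> : swapvar j ((1 - 'X_j1) * 'X_[m]) =
      (1 - 'X_j) * swapvar j 'X_[m].
    rewrite /swapvar msymM msymB msym1 msymX; congr ((1 - 'X_[_]) * _).
    apply/mnmP => i; rewrite !mnmE /sadj tpermV -/j1; congr (nat_of_bool _).
    by rewrite -[X in X == _](tpermL j j1) (inj_eq perm_inj).
  rewrite -[in LHS](with_exponents_id m) pE qE swap_with_exponents.
  by rewrite !mpolyX_with_exponents; ring.
have [le_qp|lt_pq] := leqP q p.
  have [d dE] : exists d, p = (q + d)%N by exists (p - q)%N; lia.
  exists (geo q d.+1 - geo q.+1 d).
    by rewrite mulrBr !geoE dE !exprS !exprD; ring.
  move=> m' /msuppB_le; rewrite mem_cat => /orP[]/geo_supp [i lt_i ->].
    by exists (q + (d.+1.-1 - i))%N, (q + i)%N; split=> //; lia.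
  by exists (q.+1 + (d.-1 - i))%N, (q.+1 + i)%N; split=> //; lia.
(* Here the sum of degree [p + q] is the negative one; it is empty if [q = p.+1]. *)
have [d dE] : exists d, q = (p.+1 + d)%N by exists (q - p.+1)%N; lia.
exists (geo p.+1 d.+1 - geo p.+1 d).
  by rewrite mulrBr !geoE dE !exprS !exprD; ring.
move=> m' /msuppB_le; rewrite mem_cat => /orP[]/geo_supp [i lt_i ->].
  by exists (p.+1 + (d.+1.-1 - i))%N, (p.+1 + i)%N; split=> //; lia.
by exists (p.+1 + (d.-1 - i))%N, (p.+1 + i)%N; split=> //; lia.
Qed.

(** By linearity, quotients for the single terms of [f] add up to the quotient for [f]; cancellation
    only shrinks the support. *)
Lemma msupp_idivdiff (P Q : 'X_{1..n} -> Prop) (f : Defs.poly n) :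
  (forall m, P m -> exists2 p, m j = p.+1 & forall a b,
     (minn p (m j1) <= a <= maxn p (m j1))%N ->
     (minn p (m j1) <= b <= maxn p (m j1))%N ->
     (p + m j1 <= a + b)%N -> Q (with_exponents m a b)) ->
  (forall m, m \in msupp f -> P m) ->
  forall m, m \in msupp (idivdiff j f) -> Q m.
Proof.
move=> PQ suppP.
suff [g gE gQ] : exists2 g : Defs.poly n,
    ('X_j - 'X_j1) * g = (1 - 'X_j1) * f - swapvar j ((1 - 'X_j1) * f) &
    forall m, m \in msupp g -> Q m.
  by rewrite /idivdiff (divdiff_unique gE).
rewrite (mpolyE f) big_seq; apply: (big_ind (fun f => exists2 g : Defs.poly n,
    ('X_j - 'X_j1) * g = (1 - 'X_j1) * f - swapvar j ((1 - 'X_j1) * f) &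
    forall m, m \in msupp g -> Q m)).
- exists 0; last by move=> m; rewrite msupp0.
  by rewrite !mulr0 /swapvar msym0 subr0.
- move=> f1 f2 [g1 gE1 gQ1] [g2 gE2 gQ2]; exists (g1 + g2).
    by rewrite mulrDr gE1 gE2 /swapvar !msymM msymD; ring.
  by move=> m /msuppD_le; rewrite mem_cat => /orP[/gQ1|/gQ2].
move=> m /suppP /PQ [p pE mQ].
have [g gE gQ] := idivdiff_monomial pE (erefl (m j1)).
exists (f@_m *: g).
  rewrite -scalerAr gE scalerBr; congr (_ - _); first by rewrite scalerAr.
  by rewrite -scalerAr /swapvar msymZ.
by move=> m' /msuppZ_le /gQ [a [b [-> aP bP abP]]]; apply: mQ.
Qed.

End IsobaricSupport.

(** * Rothe diagrams at the first ascent *)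

Section RotheDiagrams.
Variables (n : nat) (w : 'S_n).

Lemma decreasing_before_ascent k :
  (forall i : 'I_n, (i < k)%N -> ~~ ascent w i) ->
  forall a b : 'I_n, (a < b)%N -> (b <= k)%N -> (w b < w a)%N.
Proof.
move=> desc a [b lt_bn] /=; elim: b lt_bn => [//|b IHb] lt_bn lt_ab lt_bk.
pose b' := Ordinal (ltnW lt_bn).
have lt_step : (w (Ordinal lt_bn) < w b')%N.
  have := desc b' lt_bk; rewrite /ascent /= lt_bn /= -leqNgt.
  have -> : nextord b' = Ordinal lt_bn by apply: val_inj; rewrite /= val_nextord.
  rewrite leq_eqVlt => /orP[/eqP/val_inj/perm_inj/(congr1 val) /= | //]; lia.
have [eab|neab] := eqVneq (a : nat) b.
  by have -> : a = b' by apply: val_inj.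
by apply: ltn_trans lt_step _; apply: IHb; lia.
Qed.

Lemma mem_rothe_col i c :
  (i \in rothe_col w c) = (i < (w^-1)%g c)%N && (c < w i)%N.
Proof. by rewrite !inE. Qed.

(* For each [i], the columns containing [i] are the [w k] with [k > i]. *)
Lemma staircase_rothe : (forall j, ~~ ascent w j) ->
  forall m, m \in msupp (staircase n) ->
  forall i, m i = (\sum_c (i \in rothe_col w c))%N.
Proof.
move=> desc m /mem_msuppXP <- i; rewrite mnmE (reindex_inj (@perm_inj _ w)) /=.
rewrite (eq_bigr (fun k : 'I_n => nat_of_bool (i < k)%N)); last first.
  move=> k _; rewrite mem_rothe_col permK; congr nat_of_bool.
  case: ltnP => //= lt_ik.
  by apply: (decreasing_before_ascent (k := n)) lt_ik (ltnW (ltn_ord k)).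
have sum_lt N : (\sum_(k < N) (i < k) = N - i.+1)%N.
  by elim: N => [|N IHN]; rewrite ?big_ord0 // big_ord_recr /= IHN; lia.
by rewrite sum_lt; lia.
Qed.

Variable j : 'I_n.
Hypothesis asc : ascent w j.
Let j1 := nextord j.
Let v := rmul_s w j.

Let lt_jn : (j.+1 < n)%N. Proof. by case/andP: asc. Qed.
Let lt_wj : (w j < w j1)%N. Proof. by case/andP: asc. Qed.
Let j1E : j1 = j.+1 :> nat. Proof. exact: val_nextord. Qed.

Let vE i : v i = w (tperm j j1 i).
Proof. by rewrite /v /rmul_s permM. Qed.

Let vVE c : (v^-1)%g c = tperm j j1 ((w^-1)%g c).
Proof. by rewrite /v /rmul_s invMg permM /sadj tpermV. Qed.

(** Write [c = w k], so [k != j]. If [k = j1], neither row lies in either column because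
    [w j < w j1]; otherwise [j] and [j1] are on the same side of [k]. *)
Lemma rothe_col_row_swapped c :
  c != w j -> row_swapped j j1 (rothe_col v c) (rothe_col w c).
Proof.
move=> nec; have [k cE] : exists k, c = w k by exists (w^-1 c)%g; rewrite permKV.
have nek : k != j by apply: contraNneq nec => <-; rewrite cE.
have memv i : (i \in rothe_col v c) = (i < tperm j j1 k)%N && (c < w (tperm j j1 i))%N.
  by rewrite !inE /= vVE vE cE permK.
have memw i : (i \in rothe_col w c) = (i < k)%N && (c < w i)%N.
  by rewrite !inE /= cE permK.
have nek_val : (k : nat) <> j by move=> /val_inj; apply/eqP.
have inj_w (a b : 'I_n) : w a = w b :> nat -> a = b by move=> /val_inj /perm_inj.
split.
- move=> i ij ij1; rewrite memv memw (tpermD (z := i)) 1?eq_sym //.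
  case: tpermP => [|->|_ _] //; first by move/eqP; rewrite (negbTE nek).
  congr (_ && _); move: ij ij1; rewrite -!val_eqE /=; lia.
- rewrite memv memw tpermR; case: tpermP => [/eqP|ek|_ /eqP nek1].
  + by rewrite (negbTE nek).
  + by rewrite cE ek; lia.
  + by congr (_ && _); move: nek1; rewrite -!val_eqE /=; lia.
- rewrite memv memw tpermL; case: tpermP => [/eqP|->|_ /eqP nek1].
  + by rewrite (negbTE nek).
  + by rewrite !ltnn.
  + by congr (_ && _); move: nek1; rewrite -!val_eqE /=; lia.
- rewrite !memw => /andP[lt_jk lt_cw]; apply/andP; split; last by lia.
  have : k != j1 by apply: contraTneq lt_cw => ek; rewrite cE ek; lia.
  by rewrite -val_eqE /=; lia.
Qed.

Hypothesis first_asc : forall i : 'I_n, (i < j)%N -> ~~ ascent w i.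

Let desc (i : 'I_n) : (i < j)%N -> (w j < w i)%N.
Proof. by move=> lt_ij; apply: (decreasing_before_ascent first_asc). Qed.

(** The values decrease up to position [j], so all earlier ones exceed [w j]. *)
Lemma rothe_col_first_ascent : rothe_col w (w j) = [set i : 'I_n | (i < j)%N].
Proof.
apply/setP => i; rewrite mem_rothe_col permK inE.
by case: ltnP => //= /desc.
Qed.

Lemma rothe_col_first_ascent_swap :
  rothe_col v (w j) = [set i : 'I_n | (i < j.+1)%N].
Proof.
apply/setP => i; rewrite !inE /= vVE vE permK tpermL j1E !ltnS.
case: (ltngtP i j) => //= [lt_ij|eij]; last by rewrite (val_inj eij) tpermL.
rewrite tpermD; first exact: desc.
  by rewrite -val_eqE /=; lia.
by rewrite -val_eqE /=; lia.
Qed.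

End RotheDiagrams.

(** The bound by the maximum puts [A] inside the interval, and the full prefix count makes it at
    least as large. *)
Lemma dominates_initial (n k : nat) (A : {set 'I_n}) :
  dominates [set i : 'I_n | (i < k)%N] A -> A = [set i : 'I_n | (i < k)%N].
Proof.
set S := [set i : 'I_n | _]; case=> ltA domA; apply/eqP; rewrite eqEcard.
apply/andP; split.
  apply/subsetP => i /ltA lt_i; rewrite inE; apply: leq_trans lt_i _.
  by apply/colmax_leP => t; rewrite inE.
by rewrite -!(prefix_card_full _ (leqnn n)).
Qed.

(** * Induction on the number of noninversions *)

Definition noninversions (n : nat) (w : 'S_n) : {set 'I_n * 'I_n} :=
  [set p : 'I_n * 'I_n | (p.1 < p.2)%N && (w p.1 < w p.2)%N].

(** Applying s_j to both entries injects the noninversions of [rmul_s w j] into those of [w], and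
    misses [(j, j1)]. *)
Lemma noninversions_rmul_s (n : nat) (w : 'S_n) (j : 'I_n) :
  ascent w j -> (#|noninversions (rmul_s w j)| < #|noninversions w|)%N.
Proof.
case/andP=> lt_jn lt_wj; set j1 := nextord j in lt_wj.
have j1E : j1 = j.+1 :> nat by exact: val_nextord.
pose s := tperm j j1; pose ss (p : 'I_n * 'I_n) := (s p.1, s p.2).
have inj_ss : injective ss.
  by move=> [a b] [c d] [/perm_inj -> /perm_inj ->].
rewrite -(card_imset _ inj_ss) [X in (_ < X)%N](cardsD1 (j, j1)).
rewrite inE /= j1E leqnn lt_wj add1n ltnS subset_leq_card //.
apply/subsetP => _ /imsetP[[a b] + ->]; rewrite !inE /= /rmul_s !permM /sadj -/j1 -/s.
rewrite /ss /= -pair_eqE /=; case/andP=> lt_ab lt_w; rewrite lt_w andbT.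
move: lt_w; rewrite /s.
case: tpermP => [ea|ea|/eqP na /eqP na1]; case: tpermP => [eb|eb|/eqP nb /eqP nb1];
  rewrite ?ea ?eb ?eqxx ?andbT //= -?val_eqE /=;
  try (move: na na1); try (move: nb nb1); rewrite -?val_eqE /=; try subst a;
  try subst b; lia.
Qed.

Lemma msupp_groth_aux (n : nat) (k : nat) (w : 'S_n) :
  (#|noninversions w| <= k)%N -> forall m, m \in msupp (groth_aux k w) ->
  exists2 A : 'I_n -> {set 'I_n}, forall c, dominates (rothe_col w c) (A c) &
    forall i, m i = (\sum_c (i \in A c))%N.
Proof.
have base (u : 'S_n) : (forall j, ~~ ascent u j) -> forall m,
    m \in msupp (staircase n) -> exists2 A : 'I_n -> {set 'I_n},
    forall c, dominates (rothe_col u c) (A c) & forall i, m i = (\sum_c (i \in A c))%N.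
  move=> desc m mS; exists (rothe_col u); first by move=> c; apply: dominates_refl.
  exact: staircase_rothe mS.
elim: k w => [|k IHk] w le_wk /=.
  (* The fuel runs out only at a permutation without ascents, since an ascent is a noninversion. *)
  apply: base => j; apply: contraL le_wk => /noninversions_rmul_s; lia.
case pickE: [pick j | ascent w j] => [j|]; last first.
  by apply: base => j; move: pickE; case: pickP => // /(_ j) ->.
have [asc first_asc] := ord_pick_first pickE.
pose j1 := nextord j; pose v := rmul_s w j; pose c0 := w j.
have j1E : j1 = j.+1 :> nat by apply: val_nextord; case/andP: asc.
apply: msupp_idivdiff (IHk v _); first by case/andP: asc.
  move=> m [A domA mA].
  (* Column [c0] of D(v) is an initial interval ending at [j], so its spanning set is forced and
     makes the exponent at [j] positive. *)
  have Ac0 : A c0 = rothe_col v c0.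
    move: (domA c0); rewrite /v /c0 rothe_col_first_ascent_swap //.
    exact: dominates_initial.
  have Dvc0 : rothe_col v c0 = [set i : 'I_n | (i < j.+1)%N].
    exact: rothe_col_first_ascent_swap.
  have [p pE] : exists p, (\sum_c (j \in A c) = p.+1)%N.
    by rewrite (bigD1 c0) //= Ac0 Dvc0 inE ltnSn; eexists.
  exists p; first by rewrite mA.
  move=> a b aP bP abP.
  have Dwc0 : rothe_col w c0 = rothe_col v c0 :\ j.
    rewrite Dvc0 rothe_col_first_ascent //; apply/setP => i.
    by rewrite !inE -val_eqE /=; lia.
  have jD : j \in rothe_col v c0 by rewrite Dvc0 inE ltnSn.
  have j1D : j1 \notin rothe_col v c0 by rewrite Dvc0 inE j1E ltnn.
  have [A' [domA' suma sumb sumA']] := dominates_redistribute j1E domA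
    (fun c nec => rothe_col_row_swapped asc nec) Ac0 Dwc0 jD j1D pE
    (esym (mA j1)) aP bP abP.
  exists A' => // i; rewrite mnmE; case: eqP => [->//|/eqP ij].
  by case: eqP => [->//|/eqP ij1]; rewrite sumA' // mA.
by rewrite -ltnS; apply: leq_trans le_wk; apply: noninversions_rmul_s.
Qed.

Theorem theorem3p6 (n : nat) (R : realFieldType) (w : 'S_n) :
  (1 <= n)%N ->
  forall x : 'rV[R]_n,
    newton (R:=R) (grothendieck w) x ->
    minkowski_sum (fun j : 'I_n =>
       spanning_polytope (R:=R) (colmax (rothe_col w j)) (rothe_col w j)) x.
Proof.
move=> _; apply: newton_subset_minkowski; apply: msupp_groth_aux.
by apply: leq_trans (max_card _) _; rewrite card_prod card_ord.
Qed.
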